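(* Suppose $M$ is neither too small nor too large with respect to $N$, such that $$aN\le M\quad\text{and}\quad \log M\le bN,$$ for appropriate constants $a,b>0$, which are independent of $M$ and $N$. Then there exist an $M$-element projection system $\mathcal P$ in $\mathbb C^N$ and a constant $c>0$, which depends only on $b$, with the property that $$\mathrm{QDisc}(\mathcal P)\ge c\sqrt{N+\log M}.$$
   Context: $N$ and $M$ are natural numbers, and $\mathcal M_N(\mathbb C)$ is the set of $N\times N$ complex matrices. A projection system in $\mathbb C^N$ is a finite set $\mathcal P$ of orthogonal projections of $\mathbb C^N$, i.e. matrices $P\in\mathcal M_N(\mathbb C)$ with $P^2=P=P^*$; it is an $M$-element projection system if it has $M$ elements. A quantum coloring is a Hermitian matrix $\chi\in\mathcal M_N(\mathbb C)$ all of whose eigenvalues lie in $\{1,-1\}$. With $[A,B]=AB-BA$ and $\mathrm{tr}^2(X)=(\mathrm{tr}\,X)^2$, the quantum discrepancy of $\mathcal P$ is $$\mathrm{QDisc}(\mathcal P)=\min_{\chi\ \text{quantum coloring}}\ \max_{P\in\mathcal P}\left[\mathrm{tr}^2(\chi P)+\mathrm{tr}(\chi[\chi,P]P)\right]^{1/2}$$ (the expression in brackets is always real and non-negative). *)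

(* Defs.v *)
From HB Require Import structures.
From mathcomp Require Import all_boot all_order all_algebra.
From mathcomp Require Export finmap complex.
From mathcomp Require Import spectral.
From mathcomp Require Import boolp classical_sets reals exp.

Set Implicit Arguments.
Unset Strict Implicit.
Unset Printing Implicit Defensive.

Import Order.TTheory GRing.Theory Num.Theory.

Local Open Scope complex_scope.
Local Open Scope ring_scope.
Local Open Scope classical_set_scope.

Definition orthogonal_projection (R : realType) (N : nat)
    (P : 'M[R[i]]_N) : Prop :=
  P *m P = P /\ P \is hermsymmx.

Definition projection_system (R : realType) (N : nat)
    (PS : {fset 'M[R[i]]_N}) : Prop :=
  forall P : 'M[R[i]]_N, P \in PS -> orthogonal_projection P.

Definition quantum_coloring (R : realType) (N : nat)
    (chi : 'M[R[i]]_N) : Prop :=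
  chi \is hermsymmx /\
  forall l : R[i], eigenvalue chi l -> l = 1 \/ l = -1.

Definition commutator (R : realType) (N : nat) (A B : 'M[R[i]]_N) :
    'M[R[i]]_N :=
  A *m B - B *m A.

(* For a quantum coloring chi and an orthogonal projection P the argument of
   complex.Re is real and nonnegative, so taking the real part discards
   nothing; it only moves the value from R[i] to R. *)
Definition qdeviation (R : realType) (N : nat) (chi P : 'M[R[i]]_N) : R :=
  Num.sqrt (complex.Re ((\tr (chi *m P)) ^+ 2
                        + \tr (chi *m commutator chi P *m P))).

(* The deviations are nonnegative, so starting the maximum at 0 does not alter
   it; it only fixes the value 0 for the empty system. *)
Definition max_qdeviation (R : realType) (N : nat)
    (PS : {fset 'M[R[i]]_N}) (chi : 'M[R[i]]_N) : R :=
  \big[Num.max/0]_(P <- enum_fset PS) qdeviation chi P.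

(* The set of quantum colorings is nonempty and compact and max_qdeviation PS
   is continuous on it, so this infimum is a minimum. *)
Definition QDisc (R : realType) (N : nat) (PS : {fset 'M[R[i]]_N}) : R :=
  inf [set max_qdeviation PS chi | chi in
        [set chi : 'M[R[i]]_N | quantum_coloring chi]].

(* Main.v *)
(* A quantum coloring satisfies chi^2 = 1, so for a diagonal projection
   P = diag(q) with q in {0,1}^N the squared deviation of chi is the quadratic
   form
     sum_(k,l) (chi_kk chi_ll - chi_kl chi_lk) q_k q_l + sum_k q_k,
   whose matrix vanishes on the diagonal.  If q ranges over a sample space of
   unbiased, pairwise independent bits, then the average of q_k q_l is 1/4 for
   k <> l and that of q_k is 1/2; since sum_(k,l) chi_kl chi_lk = N, the average
   squared deviation is ((tr chi)^2 + N) / 4.  Characters of (Z/2)^m give such a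
   sample space with at most 2 N points, hence a system of at most 2 N diagonal
   projections of quantum discrepancy at least sqrt N / 2.  It may be enlarged to
   M projections, and N + log M <= (1 + b) N turns sqrt N into sqrt (N + log M). *)

Require Import Defs.
From mathcomp Require Import all_boot all_order all_algebra.
From mathcomp Require Import reals sequences exp.
From mathcomp Require Import spectral ring.

Set Implicit Arguments.
Unset Strict Implicit.
Unset Printing Implicit Defensive.

Import Order.TTheory GRing.Theory Num.Theory.
Local Open Scope complex_scope.
Local Open Scope ring_scope.

(** * Colorings are involutions *)

(** The spectral theorem writes [chi] as [U^-1 diag(d) U]. The rows of [U] are eigenvectors, so the
    entries of [d] are signs and square to 1. *)
Lemma quantum_coloring_sqr (R : realType) (N : nat) (chi : 'M[R[i]]_N) :
  quantum_coloring chi -> chi *m chi = 1%:M.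
Proof.
move=> [/hermitian_normalmx/orthomx_spectralP chiE chi_eig].
set U := spectralmx chi in chiE; set d := spectral_diag chi in chiE.
have Uu : U \in unitmx by rewrite unitarymx_unit ?spectral_unitarymx.
have dsq : diag_mx d *m diag_mx d = 1%:M.
  rewrite mulmx_diag; apply/matrixP => i j; rewrite !mxE.
  have [->|_] := eqVneq i j; rewrite ?mulr1n ?mulr0n //.
  have /chi_eig [->|->] : eigenvalue chi (d 0 j); last 2 first.
  - by rewrite mulr1.
  - by rewrite mulrNN mulr1.
  apply/eigenvalueP; exists (row j U).
    rewrite {1}chiE -row_mul -mulmxA mulKVmx // row_mul.
    by rewrite row_diag_mx -scalemxAl -rowE.
  apply/eqP => Uj0; have := row_free_unit U; rewrite Uu => /row_freeP[V UV].
  have /matrixP/(_ j j) := UV; rewrite !mxE eqxx => /eqP; apply/negP.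
  rewrite big1 ?(eq_sym 0) ?oner_neq0 // => k _.
  by have /rowP/(_ k) := Uj0; rewrite !mxE => ->; rewrite mul0r.
rewrite chiE -!mulmxA mulKVmx // (mulmxA (diag_mx d)) dsq mul1mx.
by rewrite mulVmx.
Qed.

(** * Characters and pairwise independent bits *)

(** Orthogonality of the characters of (Z/2)^T, with subsets as vectors. The sum factors over the
    points of [T]: a point contributes 2 if [A] and [B] agree there and 0 otherwise. *)
Lemma signed_meet_orthogonal (F : comPzRingType) (T : finType) (A B : {set T}) :
  \sum_(X : {set T}) (-1) ^+ #|A :&: X| * (-1) ^+ #|B :&: X|
    = (A == B)%:R * #|{set T}|%:R :> F.
Proof.
pose s (A : {set T}) i : F := if i \in A then -1 else 1.
have sE (C X : {set T}) : (-1) ^+ #|C :&: X| = \prod_i (if i \in X then s C i else 1).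
  rewrite -prodr_const -big_mkcond /= /s -big_mkcondr.
  by apply: eq_bigl => i; rewrite inE andbC.
transitivity (\prod_i (s A i * s B i + 1)).
  rewrite bigA_distr; apply: eq_bigr => X _; rewrite !sE -big_split /=.
  by apply: eq_bigr => i _; case: ifP; rewrite ?mulr1.
have [->|neqAB] := eqVneq A B.
  rewrite mul1r -cardsT -powersetT card_powerset cardsT natrX -prodr_const; apply: eq_bigr => i _.
  by rewrite /s; case: ifP; rewrite ?mulrNN mulr1.
have [i ABi] : exists i, (i \in A) != (i \in B).
  apply/existsP; rewrite -negb_forall; apply: contra neqAB => /forallP AB.
  by apply/eqP/setP => i; apply/eqP.
rewrite (bigD1 i) //= /s mul0r; move: ABi.
by do 2!case: ifP; rewrite //= ?mulr1 ?mul1r addNr mul0r.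
Qed.

(* Take 2 ^ m sample points X in (Z/2)^m with N < 2 ^ m <= 2 * N; the bits are
   the characters of N distinct nonzero elements. *)
Lemma pairwise_independent_bits (F : comPzRingType) (N : nat) : (0 < N)%N ->
  exists (J : finType) (p : J -> 'I_N -> bool),
    [/\ (0 < #|J|)%N, (#|J| <= 2 * N)%N &
      forall k l, 4 * \sum_j (p j k && p j l)%:R = (1 + (k == l)%:R) * #|J|%:R :> F].
Proof.
move=> N_gt0; set m := (trunc_log 2 N).+1.
have /andP[ge_N lt_N] := trunc_log_bounds (isT : 1 < 2)%N N_gt0.
have cardJ : #|{set 'I_m}| = (2 ^ m)%N by rewrite -cardsT -powersetT card_powerset cardsT card_ord.
have le_N : (N <= #|[set~ (set0 : {set 'I_m})]|)%N.
  by rewrite cardsC1 cardJ -ltnS prednK // expn_gt0.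
pose A k : {set 'I_m} := enum_val (widen_ord le_N k).
have A_inj : injective A by move=> k l /enum_val_inj/(congr1 val)/= /val_inj.
have A_neq0 k : A k != set0 by have := enum_valP (widen_ord le_N k); rewrite !inE.
exists {set 'I_m}, (fun X k => ~~ odd #|A k :&: X|); split.
- by rewrite cardJ expn_gt0.
- by rewrite cardJ expnS leq_mul2l.
move=> k l; pose s (B X : {set 'I_m}) : F := (-1) ^+ #|B :&: X|.
rewrite mulr_sumr.
(* A bit is (1 + s)/2 for its character s, so four times a product of two bits is (1 + s_k)(1 +
   s_l). Writing 1 as the trivial character [s set0] makes each of the four terms a case of
   orthogonality. *)
transitivity (\sum_X (s set0 X * s set0 X + s (A k) X * s set0 X
              + (s (A l) X * s set0 X + s (A k) X * s (A l) X))).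
  apply: eq_bigr => X _; rewrite /s set0I cards0 expr0 !mulr1.
  rewrite -(signr_odd _ #|A k :&: X|) -(signr_odd _ #|A l :&: X|).
  by case: odd; case: odd; rewrite ?expr0 ?expr1 /=; ring.
rewrite !big_split /= !signed_meet_orthogonal eqxx !(negPf (A_neq0 _)).
by rewrite (inj_eq A_inj) !mul0r mul1r addr0 add0r mulrDl mul1r.
Qed.

(** * Average deviation over diagonal projections *)

Lemma diag_projection (R : realType) (N : nat) (q : 'I_N -> bool) :
  orthogonal_projection (diag_mx (\row_k (q k)%:R) : 'M[R[i]]_N).
Proof.
split.
  rewrite mulmx_diag; congr diag_mx; apply/rowP => k; rewrite !mxE.
  by case: (q k); rewrite ?mulr1 ?mulr0.
rewrite is_hermitianmxE expr0 scale1r; apply/eqP/matrixP => k l; rewrite !mxE.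
rewrite eq_sym; have [->|_] := eqVneq l k; rewrite ?mulr1n ?mulr0n ?conjC0 //.
by rewrite conjC_nat.
Qed.

Definition qdeviation2 (R : realType) (N : nat) (chi P : 'M[R[i]]_N) : R[i] :=
  (\tr (chi *m P)) ^+ 2 + \tr (chi *m commutator chi P *m P).

(** As [chi] and [P] satisfy chi^2 = 1 and P^2 = P, the commutator term is tr P - tr(chi P chi P).
    The redundant [q k && q k] lets the pair averages serve the linear term too. *)
Lemma qdeviation2_diag (R : realType) (N : nat) (chi : 'M[R[i]]_N)
    (q : 'I_N -> bool) : chi *m chi = 1%:M ->
  qdeviation2 chi (diag_mx (\row_k (q k)%:R)) =
    \sum_k \sum_l (chi k k * chi l l - chi k l * chi l k) * (q k && q l)%:R
    + \sum_k (q k && q k)%:R.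
Proof.
move=> chi2; set P := diag_mx _.
have PP : P *m P = P by case: (diag_projection R q).
rewrite /qdeviation2 /commutator mulmxBr mulmxBl linearB /=.
rewrite !mulmxA chi2 mul1mx PP mxtrace_diag addrCA addrC.
have -> : \sum_j (\row_k ((q k)%:R : R[i])) 0 j = \sum_k (q k && q k)%:R.
  by apply: eq_bigr => k _; rewrite mxE andbb.
congr (_ + _).
have -> : (\tr (chi *m P)) ^+ 2
    = \sum_k \sum_l chi k k * chi l l * (q k && q l)%:R.
  have -> : \tr (chi *m P) = \sum_k chi k k * (q k)%:R.
    by apply: eq_bigr => k _; rewrite mul_mx_diag !mxE.
  rewrite expr2 big_distrlr /=; apply: eq_bigr => k _; apply: eq_bigr => l _.
  by rewrite mulrACA -mulnb natrM.
have -> : \tr (chi *m P *m chi *m P)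
    = \sum_k \sum_l chi k l * chi l k * (q k && q l)%:R.
  apply: eq_bigr => k _.
  rewrite mul_mx_diag -mulmxA !mxE mulr_suml; apply: eq_bigr => l _.
  rewrite mul_diag_mx !mxE -mulnb natrM; ring.
rewrite -sumrB; apply: eq_bigr => k _; rewrite -sumrB; apply: eq_bigr => l _.
by rewrite mulrBl.
Qed.

Lemma sum_qdeviation2 (R : realType) (N : nat) (chi : 'M[R[i]]_N) (J : finType)
    (p : J -> 'I_N -> bool) : chi *m chi = 1%:M ->
  (forall k l, 4 * \sum_j (p j k && p j l)%:R = (1 + (k == l)%:R) * #|J|%:R :> R[i]) ->
  4 * \sum_j qdeviation2 chi (diag_mx (\row_k (p j k)%:R))
    = #|J|%:R * ((\tr chi) ^+ 2 + N%:R).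
Proof.
move=> chi2 pE.
pose e k l := chi k k * chi l l - chi k l * chi l k.
have ekk k : e k k = 0 by rewrite /e subrr.
have tr2 : \sum_k \sum_l chi k l * chi l k = N%:R.
  by rewrite -(mxtrace1 _ N) -chi2; apply: eq_bigr => k _; rewrite !mxE.
transitivity (\sum_k \sum_l e k l * (4 * \sum_j (p j k && p j l)%:R)
   + \sum_k 4 * \sum_j (p j k && p j k)%:R).
  under eq_bigr do rewrite qdeviation2_diag //.
  rewrite big_split /= mulrDr exchange_big mulr_sumr; congr (_ + _); last first.
    by rewrite exchange_big mulr_sumr.
  apply: eq_bigr => k _; rewrite exchange_big mulr_sumr; apply: eq_bigr => l _.
  by rewrite -mulr_sumr mulrCA.
rewrite [X in _ + X](_ : _ = 2 * N%:R * #|J|%:R); last first.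
  under eq_bigr => k _ do rewrite pE eqxx.
  by rewrite sumr_const card_ord -mulr_natl mulr1n; ring.
(* Since [e k k] vanishes, only the off-diagonal value [#|J|] of the pair sums enters. *)
rewrite [X in X + _](_ : _ = #|J|%:R * \sum_k \sum_l e k l); last first.
  rewrite mulr_sumr; apply: eq_bigr => k _.
  rewrite mulr_sumr; apply: eq_bigr => l _; rewrite pE.
  have [->|_] := eqVneq k l; first by rewrite ekk mul0r mulr0.
  by rewrite addr0 mul1r mulrC.
rewrite [X in _ * X + _](_ : _ = (\tr chi) ^+ 2 - N%:R); last first.
  under eq_bigr do rewrite sumrB.
  by rewrite sumrB tr2 expr2 big_distrlr.
ring.
Qed.

(** The trace of a Hermitian matrix is real, so its square is nonnegative and the mean squared
    deviation is at least N/4; some [j] attains at least the mean. *)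
Lemma exists_large_qdeviation (R : realType) (N : nat) (chi : 'M[R[i]]_N)
    (J : finType) (p : J -> 'I_N -> bool) :
  (0 < #|J|)%N -> quantum_coloring chi ->
  (forall k l, 4 * \sum_j (p j k && p j l)%:R = (1 + (k == l)%:R) * #|J|%:R :> R[i]) ->
  exists j, Num.sqrt N%:R / 2 <= qdeviation chi (diag_mx (\row_k (p j k)%:R)).
Proof.
move=> J_gt0 chiP pE.
have sumE := sum_qdeviation2 (quantum_coloring_sqr chiP) pE.
have tr2_ge0 : 0 <= (\tr chi) ^+ 2.
  apply: real_exprn_even_ge0 => //; rewrite CrealE; apply/eqP; symmetry.
  have /eqP chiH : chi == (-1) ^+ false *: (map_mx Num.conj chi^T).
    by rewrite -is_hermitianmxE; case: chiP.
  rewrite [RHS]rmorph_sum; apply: eq_bigr => k _.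
  by rewrite {1}chiH !mxE expr0 mul1r.
pose X j := qdeviation2 chi (diag_mx (\row_k (p j k)%:R)).
have ReD : {morph @complex.Re R : x y / x + y} by move=> [? ?] [? ?].
have ReX : N%:R *+ #|J| <= \sum_j complex.Re (X j) *+ 4.
  have : (#|J| * N)%:R <= (\sum_j X j) *+ 4.
    by rewrite -[leRHS]mulr_natl sumE natrM mulrDr lerDr mulr_ge0.
  rewrite lecE => /andP[_]; rewrite -sumrMnl (big_morph _ ReD (erefl _)) mulnC.
  have ReMn z n : complex.Re (z *+ n : R[i]) = complex.Re z *+ n.
    by elim: n => // n IHn; rewrite !mulrS ReD IHn.
  by rewrite ReMn mulrnA; under eq_bigr do rewrite ReMn.
have [j Xj] : exists j, N%:R <= complex.Re (X j) *+ 4.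
  apply/existsP; rewrite -[[exists _, _]]negbK negb_exists.
  apply/negP => /forallP ltX; move: ReX; rewrite leNgt -sumr_const => /negP[].
  have [j0 _] := card_gt0P J_gt0.
  by apply: ltr_sum => [|j _]; [apply/hasP; exists j0; rewrite ?mem_index_enum|rewrite ltNge].
exists j; rewrite /qdeviation -/(qdeviation2 _ _) -/(X j).
have <- : Num.sqrt (2 ^+ 2) = 2 :> R by rewrite sqrtr_sqr ger0_norm.
rewrite -sqrtrV ?exprn_ge0 // -sqrtrM // ler_wsqrtr // ler_pdivrMr ?exprn_gt0 //.
by rewrite -natrX mulr_natr.
Qed.

(** * Padding to exactly M projections *)

Lemma fset_extension (T : choiceType) (f : nat -> T) (S : {fset T}) (M : nat) :
  injective f -> (#|` S| <= M)%N ->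
  exists S' : {fset T}, [/\ #|` S'| = M, {subset S <= S'} &
    forall x, x \in S' -> x \in S \/ exists n, x = f n].
Proof.
move=> f_inj; elim: M => [|M IHM].
  by rewrite leqn0 => /eqP S0; exists S; split=> // x; left.
rewrite leq_eqVlt => /orP[/eqP SM|]; first by exists S; split=> // x; left.
rewrite ltnS => /IHM[S' [S'M SS' S'f]].
(* Pigeonhole: [M.+1] distinct values of [f] cannot all lie in the [M]-element set [S']. *)
have [n fnS'] : exists n, f n \notin S'.
  have [/existsP[n]|/existsPn all_in] := boolP [exists n : 'I_M.+1, f n \notin S'].
    by exists n.
  have : (#|` [fset f (val n) | n in 'I_M.+1]%fset| <= #|` S'|)%N.
    apply/fsubset_leq_card/fsubsetP => _ /imfsetP[n _ ->].
    by have := all_in n; rewrite negbK.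
  rewrite S'M card_imfset; last by move=> i j /f_inj/val_inj.
  by rewrite -cardE card_ord ltnn.
exists (f n |` S')%fset; split.
- by rewrite cardfsU1 fnS' S'M.
- by move=> x /SS' xS'; rewrite in_fset1U xS' orbT.
- by move=> x; rewrite in_fset1U => /orP[/eqP->|/S'f//]; right; exists n.
Qed.

(** Project onto the lines spanned by e_0 + t e_last, with t a natural number; 1 < N makes the two
    basis vectors distinct. These vectors are real, so the transpose is the adjoint. *)
Lemma infinitely_many_projections (R : realType) (N : nat) : (1 < N)%N ->
  exists f : nat -> 'M[R[i]]_N,
    injective f /\ forall t, orthogonal_projection (f t).
Proof.
case: N => [|[|N]]// _.
pose v (t : nat) : 'rV[R[i]]_N.+2 := delta_mx 0 0 + t%:R *: delta_mx 0 ord_max.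
pose c (t : nat) : R[i] := (1 + t%:R ^+ 2).
have c_neq0 t : c t != 0 by rewrite /c -natrX nat1r pnatr_eq0.
have vv t : v t *m (v t)^T = (c t)%:M.
  rewrite /v linearD /= linearZ /= !trmx_delta mulmxDl !mulmxDr.
  rewrite -!scalemxAl -!scalemxAr !mul_delta_mx_cond /= mulr0n !mulr1n.
  by apply/matrixP => i j; rewrite !ord1 eqxx !mulr1n !mxE /=
    !mulr0 add0r addr0 mulr1.
exists (fun t => (c t)^-1 *: ((v t)^T *m v t)); split.
  (* The corner entry 1/(1 + t^2) already determines t. *)
  move=> s t /= /matrixP/(_ 0 0); rewrite !mxE.
  have vt0 u : \sum_j ((v u)^T 0 j * v u j 0) = 1.
    by rewrite big_ord1 !mxE /= mulr0 addr0 mulr1.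
  rewrite !vt0 !mulr1 => /invr_inj/addrI.
  by rewrite -!natrX => /eqP; rewrite eqr_nat eqn_sqr => /eqP.
move=> t; split.
  rewrite -scalemxAl -scalemxAr mulmxA -(mulmxA _ (v t)) vv mul_mx_scalar.
  by rewrite -scalemxAl scalerA [_ * c t]mulVf // scale1r.
rewrite is_hermitianmxE expr0 scale1r; apply/eqP/matrixP => k l; rewrite !mxE.
rewrite !big_ord1 !mxE rmorphM fmorphV /c !rmorphD rmorphXn !rmorphM !rmorphD !rmorphM /=.
by rewrite !rmorph_nat rmorph1 [X in _ * X]mulrC.
Qed.

(** * Lower bounds on the discrepancy *)

Lemma quantum_coloring1 (R : realType) (N : nat) :
  quantum_coloring (1%:M : 'M[R[i]]_N).
Proof.
split; first exact: hermitian1mx_subproof.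
move=> l /eigenvalueP[u]; rewrite mulmx1 => /eqP; rewrite -subr_eq0.
rewrite -{1}[u]scale1r -scalerBl scaler_eq0 subr_eq0.
by move=> /orP[/eqP<-|->//]; left.
Qed.

Lemma QDisc_ge (R : realType) (N : nat) (PS : {fset 'M[R[i]]_N}) (x : R) :
  (forall chi, quantum_coloring chi -> exists2 P, P \in PS & x <= qdeviation chi P) ->
  x <= QDisc PS.
Proof.
move=> xP; apply: lb_le_inf.
  by exists (max_qdeviation PS 1%:M); exists 1%:M => //; exact: quantum_coloring1.
move=> _ [chi /xP[P PPS xle] <-].
exact: bigmax_sup_seq xle.
Qed.

Lemma QDisc_ge0 (R : realType) (N : nat) (PS : {fset 'M[R[i]]_N}) : 0 <= QDisc PS.
Proof.
apply: lb_le_inf.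
  by exists (max_qdeviation PS 1%:M); exists 1%:M => //; exact: quantum_coloring1.
by move=> _ [chi _ <-]; exact: bigmax_ge_id.
Qed.

Lemma projection_system_sqrt (R : realType) (N M : nat) :
  (1 < N)%N -> (2 * N <= M)%N ->
  exists PS : {fset 'M[R[i]]_N},
    [/\ projection_system PS, #|` PS|%fset = M & Num.sqrt N%:R / 2 <= QDisc PS].
Proof.
move=> N_gt1 leNM.
have [J [p [J_gt0 leJ pE]]] := pairwise_independent_bits R[i] (ltnW N_gt1).
pose D j : 'M[R[i]]_N := diag_mx (\row_k (p j k)%:R).
have [f [f_inj fP]] := infinitely_many_projections R N_gt1.
(* The [D j] may coincide, so their number is only bounded above; padding makes up the difference
   and cannot lower the maximum. *)
have leDM : (#|` [fset D j | j in J]%fset| <= M)%N.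
  apply: leq_trans (leq_trans leJ leNM).
  by apply: leq_trans (leq_imfset_card _ _ _) _; rewrite -cardE.
have [PS [PSM DPS PSf]] := fset_extension f_inj leDM.
exists PS; split=> // [P /PSf[/imfsetP[j _ ->]|[n ->]]|] //.
  exact: diag_projection.
apply: QDisc_ge => chi chiP.
have [j devj] := exists_large_qdeviation J_gt0 chiP pE.
by exists (D j) => //; apply/DPS/imfsetP; exists j.
Qed.

Theorem theorem4 (R : realType) (b : R) (b_gt0 : 0 < b) :
  exists c : R, 0 < c /\
  exists a : R, 0 < a /\
  forall N M : nat,
    a * N%:R <= M%:R -> ln M%:R <= b * N%:R ->
    exists PS : {fset 'M[R[i]]_N},
      [/\ projection_system PS,
          #|` PS|%fset = M &
          c * Num.sqrt (N%:R + ln M%:R) <= QDisc PS].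
Proof.
have b1_gt0 : 0 < 1 + b by rewrite addr_gt0.
(* Chosen so that N + ln M <= (1 + b) N turns the bound sqrt N / 2 into the required one. *)
exists (2 * Num.sqrt (1 + b))^-1; split; first by rewrite invr_gt0 mulr_gt0 ?sqrtr_gt0.
(* [expR b < a] rules out N = 1, where only two projections exist. *)
exists (2 + expR b); split; first by rewrite addr_gt0 ?expR_gt0.
move=> [|[|N]] M leNM lnM.
(* For N = 0 the hypothesis ln M <= 0 leaves M = 0 or 1. With the convention ln 0 = 0 the bound to
   prove is 0 in both cases. *)
- have leM1 : (M <= 1)%N.
    case: M lnM {leNM} => // M; rewrite mulr0 => lnM.
    by rewrite -(ler_nat R) -ler_ln ?posrE // ln1.
  have lnM0 : ln M%:R = 0 :> R by case: M leM1 {leNM lnM} => [|[|]]// _; rewrite ?ln1 ?ln0.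
  exists (if M is 0 then fset0 else [fset (0 : 'M[R[i]]_0)])%fset; split.
  + by move=> P _; split; [rewrite [LHS]flatmx0 [RHS]flatmx0|rewrite is_hermitianmxE; apply/eqP/matrixP; case].
  + by case: M leM1 {leNM lnM lnM0} => [|[|]]// _; rewrite ?cardfs0 ?cardfs1.
  + by rewrite lnM0 addr0 sqrtr0 mulr0 QDisc_ge0.
- have M_gt : expR b < M%:R by apply: lt_le_trans leNM; rewrite mulr1 ltrDr.
  move: lnM; rewrite mulr1 -ler_expR lnK.
    by rewrite leNgt M_gt.
  by rewrite posrE (lt_trans _ M_gt) ?expR_gt0.
(* The summand 2 of [a] makes room for the sample space of at most 2N points. *)
have le2NM : (2 * N.+2 <= M)%N.
  rewrite -(ler_nat R) natrM (le_trans _ leNM) // ler_wpM2r //.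
  by rewrite lerDl expR_ge0.
have [PS [PSP PSM PSge]] := projection_system_sqrt R (isT : 1 < N.+2)%N le2NM.
exists PS; split=> //; apply: le_trans PSge.
rewrite invfM mulrAC -mulrA [leRHS]mulrC ler_pM2l ?invr_gt0 //.
rewrite ler_pdivrMr ?sqrtr_gt0 // -sqrtrM // ler_wsqrtr //.
by rewrite mulrDr mulr1 lerD2l mulrC.
Qed.
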